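(* For a weak $f$-K-contact manifold $M^{2n+s}(f,Q,\xi_i,\eta^i,g)$, the $\xi$-sectional curvature is positive: $$K(\xi_i,X)=g(QX,X)>0\qquad(X\in\mathcal D,\ \|X\|=1,\ 1\le i\le s),$$ and the Ricci curvature satisfies $\operatorname{Ric}(\xi_i,\xi_j)>0$ for all $1\le i,j\le s$.
   Context: Let $n,s\ge1$ and let $M=M^{2n+s}$ be a smooth manifold of dimension $2n+s$. A weak metric $f$-structure on $M$ is a set $(f,Q,\xi_i,\eta^i,g)$ $(i=1,\dots,s)$, where $f$ is a $(1,1)$-tensor, $Q$ is a nonsingular $(1,1)$-tensor, $\xi_i$ are vector fields (the characteristic vector fields), $\eta^i$ are 1-forms and $g$ is a Riemannian metric, such that $$f^2=-Q+\sum_i\eta^i\otimes\xi_i,\quad \eta^i(\xi_j)=\delta^i_j,\quad Q\,\xi_i=\xi_i,$$ the $2n$-dimensional distribution $\mathcal D:=\bigcap_i\ker\eta^i$ is $f$-invariant ($fX\in\mathcal D$ for $X\in\mathcal D$), and $g(fX,fY)=g(X,QY)-\sum_i\eta^i(X)\,\eta^i(Y)$ for all vector fields $X,Y$. Put $\Phi(X,Y)=g(X,fY)$. The exterior derivative of a 1-form is normalized by $d\eta(X,Y)=\frac12\{X(\eta(Y))-Y(\eta(X))-\eta([X,Y])\}$. The structure is weak $f$-contact if $\Phi=d\eta^1=\dots=d\eta^s$; a weak $f$-contact structure is weak $f$-K-contact if all $\xi_i$ are Killing for $g$. $K(\xi_i,X)$ is the sectional curvature of the plane spanned by $\xi_i$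 and $X$; sectional curvatures of planes spanned by unit vectors $\xi\in\ker f=\mathrm{span}(\xi_1,\dots,\xi_s)$ and $X\in\mathcal D$ are called $\xi$-sectional curvatures. $\operatorname{Ric}$ is the Ricci tensor of $g$. *)

(* Defs.v *)
From HB Require Import structures.
From mathcomp Require Import all_boot all_order all_algebra.
From mathcomp Require Import all_classical all_reals all_analysis.
From mathcomp Require Import ring.

Set Implicit Arguments.
Unset Strict Implicit.
Unset Printing Implicit Defensive.

Import Order.TTheory GRing.Theory Num.Theory.
Import numFieldNormedType.Exports.

Local Open Scope classical_set_scope.
Local Open Scope ring_scope.

Section smooth_on.
Variables (R : realType) (m : nat).
Implicit Types (U : set 'rV[R]_m) (F G : 'rV[R]_m -> R) (k : nat).

(* Meant for an open U: F is continuous on U and its iterated partial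
   derivatives up to order k exist and are continuous on U. *)
Fixpoint Ck k U F : Prop :=
  (forall x, U x -> {for x, continuous F}) /\
  if k is k'.+1 then
    forall j : 'I_m, (forall x, U x -> derivable F x (delta_mx 0 j)) /\
                     Ck k' U (fun x => 'D_(delta_mx 0 j) F x)
  else True.

Definition smooth_on U F : Prop := forall k, Ck k U F.

Lemma Ck_continuous k U F :
  Ck k U F -> forall x, U x -> {for x, continuous F}.
Proof. by case: k => [|k] []. Qed.

Lemma CkW k U F : Ck k.+1 U F -> Ck k U F.
Proof.
elim: k F => [|k IH] F [cF dF]; split => // j.
by have [? /IH] := dF j.
Qed.

Lemma Ck_ext k U F G : open U -> (forall x, U x -> F x = G x) ->
  Ck k U F -> Ck k U G.
Proof.
move=> oU.
have nearU F' G' x : (forall y, U y -> F' y = G' y) -> U x ->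
    \forall y \near x, F' y = G' y.
  by move=> FG Ux; apply: filterS (open_nbhs_nbhs (conj oU Ux)).
have cont F' G' : (forall y, U y -> F' y = G' y) ->
    (forall x, U x -> {for x, continuous F'}) ->
    forall x, U x -> {for x, continuous G'}.
  move=> FG cF x Ux; rewrite /prop_for /continuous_at -(FG x Ux).
  by apply: cvg_trans (cF x Ux); exact: (near_eq_cvg (nearU _ _ _ FG Ux)).
elim: k F G => [|k IH] F G FG [cF dF].
  by split=> //; exact: cont cF.
split=> [|j]; first exact: cont cF.
have [dFj CFj] := dF j; split=> [x Ux|].
  by apply: near_eq_derivable (dFj x Ux); exact: (nearU _ _ _ FG Ux).
by apply: IH CFj => x Ux; apply: near_eq_derive; exact: (nearU _ _ _ FG Ux).
Qed.

Lemma Ck_cst k U (a : R) : open U -> Ck k U (fun=> a).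
Proof.
move=> oU; elim: k a => [|k IH] a.
  by split=> // x _; exact: cst_continuous.
split=> [x _|j]; first exact: cst_continuous.
split=> [x _|]; first exact: (derivable_cst a).
by apply: Ck_ext (IH 0) => // x _; exact/esym/(derive_cst a).
Qed.

Lemma Ck_add k U F G : open U -> Ck k U F -> Ck k U G ->
  Ck k U (fun x => F x + G x).
Proof.
move=> oU; elim: k F G => [|k IH] F G [cF dF] [cG dG].
  by split=> // x Ux; exact: (continuousD (cF x Ux) (cG x Ux)).
split=> [x Ux|j]; first by exact: (continuousD (cF x Ux) (cG x Ux)).
have [dFj CFj] := dF j; have [dGj CGj] := dG j; split=> [x Ux|].
  by apply: derivableD; [exact: dFj|exact: dGj].
apply: Ck_ext (IH _ _ CFj CGj) => // x Ux.
by rewrite -deriveD//; [exact: dFj|exact: dGj].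
Qed.

Lemma Ck_mul k U F G : open U -> Ck k U F -> Ck k U G ->
  Ck k U (fun x => F x * G x).
Proof.
move=> oU; elim: k F G => [|k IH] F G CF CG.
  by split=> // x Ux; exact: (continuousM (Ck_continuous CF Ux) (Ck_continuous CG Ux)).
split=> [x Ux|j]; first by exact: (continuousM (Ck_continuous CF Ux) (Ck_continuous CG Ux)).
have [_ /(_ j)[dFj CFj]] := CF; have [_ /(_ j)[dGj CGj]] := CG.
split=> [x Ux|]; first by apply: derivableM; [exact: dFj|exact: dGj].
apply: Ck_ext (Ck_add oU (IH _ _ (CkW CF) CGj) (IH _ _ (CkW CG) CFj)) => //.
by move=> x Ux; rewrite (deriveM (dFj x Ux) (dGj x Ux)).
Qed.

End smooth_on.

Section manifold.
Variables (R : realType) (m : nat).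

(* chart_map and chart_inv are total functions; only their values on chart_dom
   and on its image matter. *)
Record chart (M : topologicalType) := Chart {
  chart_dom : set M;
  chart_map :> M -> 'rV[R]_m;
  chart_inv : 'rV[R]_m -> M;
  chart_dom_open : open chart_dom;
  chart_img_open : open (chart_map @` chart_dom);
  chart_mapK : forall p, chart_dom p -> chart_inv (chart_map p) = p;
  chart_map_continuous : forall p, chart_dom p -> {for p, continuous chart_map};
  chart_inv_continuous : forall x, (chart_map @` chart_dom) x ->
    {for x, continuous chart_inv} }.

Record manifold := Manifold {
  carrier :> topologicalType;
  carrier_hausdorff : hausdorff_space carrier;
  carrier_second_countable : @second_countable carrier;
  atlas : set (chart carrier);
  atlas_cover : forall p, exists2 c, atlas c & chart_dom c p;
  atlas_compat : forall c d, atlas c -> atlas d -> forall j : 'I_m,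
    smooth_on (c @` (chart_dom c `&` chart_dom d))
              (fun x => d (chart_inv c x) 0 j) }.

End manifold.

Section smooth_functions.
Variables (R : realType) (m : nat) (M : manifold R m).

Definition smooth (h : M -> R) : Prop := forall c, atlas c ->
  smooth_on (c @` chart_dom c) (h \o chart_inv c).

Definition smooth_pred : {pred M -> R} := [pred h | `[< smooth h >]].

Lemma smooth_cst (a : R) : smooth (fun=> a).
Proof. by move=> c _ k; apply: Ck_cst; exact: chart_img_open. Qed.

Lemma smooth_add h1 h2 : smooth h1 -> smooth h2 ->
  smooth (fun p => h1 p + h2 p).
Proof.
move=> s1 s2 c ac k.
by apply: Ck_add; [exact: chart_img_open|exact: s1|exact: s2].
Qed.

Lemma smooth_mul h1 h2 : smooth h1 -> smooth h2 ->
  smooth (fun p => h1 p * h2 p).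
Proof.
move=> s1 s2 c ac k.
by apply: Ck_mul; [exact: chart_img_open|exact: s1|exact: s2].
Qed.

Lemma smooth_opp h : smooth h -> smooth (fun p => - h p).
Proof.
move=> /(smooth_mul (smooth_cst (-1))).
by under eq_fun do rewrite mulN1r.
Qed.

Lemma smooth_subring_closed : subring_closed smooth_pred.
Proof.
split=> [|h1 h2 /asboolP s1 /asboolP s2|h1 h2 /asboolP s1 /asboolP s2];
  apply/asboolP.
- exact: smooth_cst.
- by apply: smooth_add => //; exact: smooth_opp.
- exact: smooth_mul.
Qed.

Lemma smooth_subsemimod_closed : subsemimod_closed smooth_pred.
Proof.
split=> [|a h /asboolP s]; last first.
  by apply/asboolP/smooth_mul => //; exact: smooth_cst.
split=> [|h1 h2 /asboolP s1 /asboolP s2]; apply/asboolP; first exact: smooth_cst.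
exact: smooth_add.
Qed.

(* The ring C^infty(M), which is also an R-module. *)
Record Cinf := MkCinf {
  Cinf_fun :> M -> R;
  Cinf_subproof : Cinf_fun \in smooth_pred }.

HB.instance Definition _ := [isSub for Cinf_fun].
HB.instance Definition _ := [Choice of Cinf by <:].
HB.instance Definition _ := GRing.SubChoice_isSubComPzRing.Build
  (M -> R) smooth_pred Cinf smooth_subring_closed.
HB.instance Definition _ := GRing.SubZmodule_isSubLmodule.Build
  R (M -> R) smooth_pred Cinf smooth_subsemimod_closed.

Definition Cinf_of (h : M -> R) (sh : smooth h) : Cinf :=
  MkCinf (asboolT sh : h \in smooth_pred).

Lemma Cinf_smooth (h : Cinf) : smooth h.
Proof. by case: h => h /= /asboolP. Qed.

End smooth_functions.

Section tangent.
Variables (R : realType) (m : nat) (M : manifold R m).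

Definition derivation_at (p : M) (v : Cinf M -> R) : Prop :=
  (forall (a : R) h k, v (a *: h + k) = a * v h + v k) /\
  (forall h k, v (h * k) = h p * v k + k p * v h).

Definition derivations_at (p : M) : {pred Cinf M -> R} :=
  [pred v | `[< derivation_at p v >]].

Lemma derivations_subsemimod_closed p : subsemimod_closed (derivations_at p).
Proof.
split; first split.
- apply/asboolP; split=> [a h k|h k].
    by change (0 = a * 0 + 0 :> R); rewrite mulr0 addr0.
  by change (0 = h p * 0 + k p * 0 :> R); rewrite !mulr0 addr0.
- move=> v w /asboolP[vl vm] /asboolP[wl wm]; apply/asboolP; split=> [a h k|h k].
    by rewrite /= !fctE vl wl mulrDr addrACA.
  by rewrite /= !fctE vm wm !mulrDr addrACA.
- move=> b v /asboolP[vl vm]; apply/asboolP; split=> [a h k|h k].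
    by rewrite /= !fctE vl scalerDr scalerAr.
  by rewrite /= !fctE vm scalerDr !scalerAr.
Qed.

(* The tangent space T_pM, as the space of derivations of C^infty(M) at p. *)
Record tangent (p : M) := MkTangent {
  tangent_fun :> Cinf M -> R;
  tangent_subproof : tangent_fun \in derivations_at p }.

HB.instance Definition _ p := [isSub for @tangent_fun p].
HB.instance Definition _ p := [Choice of tangent p by <:].
HB.instance Definition _ p := GRing.SubChoice_isSubLmodule.Build
  R (Cinf M -> R) (derivations_at p) (tangent p) (derivations_subsemimod_closed p).

Definition tangent_of p v (dv : derivation_at p v) : tangent p :=
  MkTangent (asboolT dv : v \in derivations_at p).

Lemma tangentP p (v : tangent p) : derivation_at p v.
Proof. by case: v => v /= /asboolP. Qed.

End tangent.

Section vector_fields.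
Variables (R : realType) (m : nat) (M : manifold R m).

Record vfield := MkVfield {
  vfield_fun :> forall p : M, tangent p;
  vfield_smooth : forall h : Cinf M, smooth (fun p => vfield_fun p h) }.

HB.instance Definition _ := gen_eqMixin vfield.
HB.instance Definition _ := gen_choiceMixin vfield.

Lemma vfieldP (X Y : vfield) : (forall p, X p = Y p) -> X = Y.
Proof.
case: X Y => [X sX] [Y sY] /= XY.
have {}XY : X = Y by apply: functional_extensionality_dep.
by rewrite {}XY in sX *; congr MkVfield; exact: Prop_irrelevance.
Qed.

Lemma vfield_smooth0 (h : Cinf M) :
  smooth (fun p => (0 : tangent p) h).
Proof. exact: smooth_cst. Qed.
Definition vfield0 := MkVfield vfield_smooth0.

Lemma vfield_smoothD (X Y : vfield) (h : Cinf M) :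
  smooth (fun p => (X p + Y p) h).
Proof. by apply: smooth_add; exact: vfield_smooth. Qed.
Definition vfieldD X Y := MkVfield (vfield_smoothD X Y).

Lemma vfield_smoothN (X : vfield) (h : Cinf M) : smooth (fun p => (- X p) h).
Proof. by apply: smooth_opp; exact: vfield_smooth. Qed.
Definition vfieldN X := MkVfield (vfield_smoothN X).

Lemma vfield_smoothZ (k : Cinf M) (X : vfield) (h : Cinf M) :
  smooth (fun p => (k p *: X p) h).
Proof.
by apply: smooth_mul; [exact: Cinf_smooth|exact: vfield_smooth].
Qed.
Definition vfieldZ k X := MkVfield (vfield_smoothZ k X).

Fact vfield_addA : associative vfieldD.
Proof. by move=> X Y Z; apply: vfieldP => p; exact: addrA. Qed.
Fact vfield_addC : commutative vfieldD.
Proof. by move=> X Y; apply: vfieldP => p; exact: addrC. Qed.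
Fact vfield_add0 : left_id vfield0 vfieldD.
Proof. by move=> X; apply: vfieldP => p; exact: add0r. Qed.
Fact vfield_addN : left_inverse vfield0 vfieldN vfieldD.
Proof. by move=> X; apply: vfieldP => p; exact: addNr. Qed.

HB.instance Definition _ := GRing.isZmodule.Build vfield
  vfield_addA vfield_addC vfield_add0 vfield_addN.

Fact vfield_scaleA h k X : vfieldZ h (vfieldZ k X) = vfieldZ (h * k) X.
Proof. by apply: vfieldP => p; exact: scalerA. Qed.
Fact vfield_scale1 : left_id 1 vfieldZ.
Proof. by move=> X; apply: vfieldP => p; exact: scale1r. Qed.
Fact vfield_scaleDr : right_distributive vfieldZ +%R.
Proof. by move=> h X Y; apply: vfieldP => p; exact: scalerDr. Qed.
Fact vfield_scaleDl X : {morph vfieldZ^~ X : h k / h + k}.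
Proof. by move=> h k; apply: vfieldP => p; exact: scalerDl. Qed.

HB.instance Definition _ := GRing.Zmodule_isLmodule.Build (Cinf M) vfield
  vfield_scaleA vfield_scale1 vfield_scaleDr vfield_scaleDl.

(* act X h is the function X(h) *)
Definition act (X : vfield) (h : Cinf M) : Cinf M :=
  Cinf_of (vfield_smooth X h).

Lemma act_linear X (a : R) h k : act X (a *: h + k) = a *: act X h + act X k.
Proof.
by apply: val_inj; apply/funext => p; have [/(_ a h k)] := tangentP (X p).
Qed.

Lemma actM X h k : act X (h * k) = h * act X k + k * act X h.
Proof.
by apply: val_inj; apply/funext => p; have [_ /(_ h k)] := tangentP (X p).
Qed.

Lemma bracket_derivation (X Y : vfield) p :
  derivation_at p (fun h => X p (act Y h) - Y p (act X h)).
Proof.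
have [Xl Xm] := tangentP (X p); have [Yl Ym] := tangentP (Y p).
split=> [a h k|h k].
  by rewrite !act_linear Xl Yl mulrBr opprD addrACA.
have XD u v : X p (u + v) = X p u + X p v.
  by have := Xl 1 u v; rewrite scale1r mul1r.
have YD u v : Y p (u + v) = Y p u + Y p v.
  by have := Yl 1 u v; rewrite scale1r mul1r.
rewrite !actM XD YD !Xm !Ym /= !mulrBr.
rewrite (mulrC (X p k)) (mulrC (X p h)); ring.
Qed.

Lemma bracket_smooth (X Y : vfield) (h : Cinf M) :
  smooth (fun p => tangent_of (bracket_derivation X Y p) h).
Proof.
apply: (smooth_add (h1 := act X (act Y h))); first exact: Cinf_smooth.
exact: (smooth_opp (Cinf_smooth (act Y (act X h)))).
Qed.

Definition bracket (X Y : vfield) : vfield := MkVfield (bracket_smooth X Y).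

End vector_fields.

Section tensors.
Variables (R : realType) (m : nat) (M : manifold R m).
Local Notation vfield := (vfield M).

Record tensor11 := Tensor11 {
  tensor11_fun :> forall p : M, {linear tangent p -> tangent p};
  tensor11_smooth : forall (X : vfield) (h : Cinf M),
    smooth (fun p => tensor11_fun p (X p) h) }.

Record oneform := Oneform {
  oneform_fun :> forall p : M, {linear tangent p -> R^o};
  oneform_smooth : forall X : vfield, smooth (fun p => oneform_fun p (X p)) }.

Record metric := Metric {
  metric_fun :> forall p : M, tangent p -> tangent p -> R;
  metric_linear : forall p (a : R) (u v w : tangent p),
    @metric_fun p (a *: u + v) w = a * @metric_fun p u w + @metric_fun p v w;
  metric_sym : forall p (u v : tangent p), @metric_fun p u v = @metric_fun p v u;
  metric_gt0 : forall p (v : tangent p), v != 0 -> 0 < @metric_fun p v v;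
  metric_smooth : forall X Y : vfield,
    smooth (fun p => @metric_fun p (X p) (Y p)) }.

Definition tapp (F : tensor11) (X : vfield) : vfield :=
  MkVfield (tensor11_smooth F X).

Definition fapp (eta : oneform) (X : vfield) : Cinf M :=
  Cinf_of (oneform_smooth eta X).

Definition mapp (g : metric) (X Y : vfield) : Cinf M :=
  Cinf_of (metric_smooth g X Y).

Definition dform (eta : oneform) (X Y : vfield) : Cinf M :=
  2^-1 *: (act X (fapp eta Y) - act Y (fapp eta X) - fapp eta (bracket X Y)).

(* the Lie derivative of g along xi vanishes *)
Definition killing (g : metric) (xi : vfield) : Prop := forall X Y,
  act xi (mapp g X Y) = mapp g (bracket xi X) Y + mapp g X (bracket xi Y).

Record connection := Connection {
  nabla :> vfield -> vfield -> vfield;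
  nabla_linearl : forall (h : Cinf M) X X' Y,
    nabla (h *: X + X') Y = h *: nabla X Y + nabla X' Y;
  nablaDr : forall X Y Y', nabla X (Y + Y') = nabla X Y + nabla X Y';
  nablaZr : forall (h : Cinf M) X Y,
    nabla X (h *: Y) = act X h *: Y + h *: nabla X Y }.

Definition levi_civita (g : metric) (D : connection) : Prop :=
  (forall X Y, D X Y - D Y X = bracket X Y) /\
  (forall X Y Z, act X (mapp g Y Z) = mapp g (D X Y) Z + mapp g Y (D X Z)).

Definition curvature (D : connection) (X Y Z : vfield) : vfield :=
  D X (D Y Z) - D Y (D X Z) - D (bracket X Y) Z.

(* Curvature is tensorial, so the next two values at p depend on the vector
   fields only through their values at p. *)
Definition sectional (g : metric) (D : connection) (X Y : vfield) (p : M) : R :=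
  mapp g (curvature D X Y Y) X p /
  (mapp g X X p * mapp g Y Y p - mapp g X Y p ^+ 2).

(* Ric_p(X, Y), the trace of Z |-> R(Z, X)Y on T_pM, computed with vector fields
   E_1, ..., E_m that form an orthonormal basis of T_pM at p. *)
Definition orthonormal_at (g : metric) (p : M) (E : 'I_m -> vfield) : Prop :=
  forall a b, g p (E a p) (E b p) = (a == b)%:R.

Definition ricci (g : metric) (D : connection) (E : 'I_m -> vfield)
    (X Y : vfield) (p : M) : R :=
  \sum_a mapp g (curvature D (E a) X Y) (E a) p.

End tensors.

Section weak_f_structures.
Variables (R : realType) (n s : nat) (M : manifold R (n.*2 + s)).
Variables (f Q : tensor11 M) (xi : 'I_s -> vfield M) (eta : 'I_s -> oneform M).
Variable g : metric M.

Definition in_D (p : M) (v : tangent p) : Prop := forall i, eta i p v = 0.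

(* That D has rank 2n is a consequence of eta^i(xi_j) = delta^i_j. *)
Record weak_metric_f_structure : Prop := WeakMetricFStructure {
  wmf_sqr : forall p (v : tangent p),
    f p (f p v) = - Q p v + \sum_i (eta i p v : R) *: xi i p;
  wmf_nonsingular : forall p, bijective (Q p);
  wmf_dual : forall i j p, eta i p (xi j p) = (i == j)%:R;
  wmf_Qxi : forall i p, Q p (xi i p) = xi i p;
  wmf_invariant : forall p (v : tangent p), in_D v -> in_D (f p v);
  wmf_compat : forall p (u v : tangent p),
    g p (f p u) (f p v) = g p u (Q p v) - \sum_i (eta i p u * eta i p v : R) }.

Definition Phi (X Y : vfield M) : Cinf M := mapp g X (tapp f Y).

Definition weak_f_contact : Prop :=
  weak_metric_f_structure /\ forall i X Y, Phi X Y = dform (eta i) X Y.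

Definition weak_f_K_contact : Prop :=
  weak_f_contact /\ forall i, killing g (xi i).

End weak_f_structures.

(* Main.v *)
(* On vector fields, [Phi = d eta^i] makes [f] skew, hence [f xi_i = 0] and
   [eta^i = g(., xi_i)]. As [xi_i] is Killing, [d eta^i(X, Y) = g(D_X xi_i, Y)],
   so [D_X xi_i = - f X] for every [i]; moreover [L_xi_i] annihilates [g] and
   every [eta^j], hence [Phi] and [f]. Therefore [R(xi_i, X) xi_j = f^2 X], so
   that [K(xi_i, X) = g(f X, f X) = g(Q X, X)] on unit vectors of the contact
   distribution, and [Ric(xi_i, xi_j)] is the squared norm of [f]. *)
Require Import Defs.
From mathcomp Require Import all_boot all_order all_algebra.
From mathcomp Require Import all_classical all_reals all_analysis.
From mathcomp Require Import ring lra.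
Import Order.TTheory GRing.Theory Num.Theory.
Local Open Scope ring_scope.

(** * Vector fields as derivations, and their Lie brackets *)

Section vector_field_calculus.
Set Implicit Arguments.
Context {R : realType} {m : nat} {M : manifold R m}.
Implicit Types (X Y Z V W : vfield M) (h k : Cinf M).

Lemma Cinf_eq h k : (forall p, h p = k p) -> h = k.
Proof. by move=> hk; apply: val_inj; exact/funext. Qed.

Lemma CinfD h k p : (h + k) p = h p + k p. Proof. by []. Qed.
Lemma CinfN h p : (- h) p = - h p. Proof. by []. Qed.
Lemma CinfZ (a : R) h p : (a *: h) p = a * h p. Proof. by []. Qed.
Definition CinfE := (CinfD, CinfN, CinfZ).

Lemma actB X h k : act X (h - k) = act X h - act X k.
Proof. by rewrite addrC -scaleN1r act_linear scaleN1r addrC. Qed.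

Lemma act0 X : act X 0 = 0.
Proof. by rewrite -{1}(subrr 0) actB subrr. Qed.

Lemma actD X h k : act X (h + k) = act X h + act X k.
Proof. by rewrite -{1}[k]opprK actB -sub0r actB act0 sub0r opprK. Qed.

Lemma actZ X (a : R) h : act X (a *: h) = a *: act X h.
Proof. by have := act_linear X a h 0; rewrite act0 !addr0. Qed.

Lemma act_bracket X Y h :
  act (bracket X Y) h = act X (act Y h) - act Y (act X h).
Proof. exact: val_inj. Qed.

Lemma act_addv X Y h : act (X + Y) h = act X h + act Y h.
Proof. exact: val_inj. Qed.

(** Tangent vectors are derivations, so identities between brackets can be tested on functions. *)
Lemma vfield_act_eq X Y : (forall h, act X h = act Y h) -> X = Y.
Proof.
move=> XY; apply: vfieldP => p; apply: val_inj; apply/funext => h.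
exact: (congr1 (fun k : Cinf M => k p) (XY h)).
Qed.

Lemma bracket_jacobi X Y Z :
  bracket X (bracket Y Z) = bracket (bracket X Y) Z + bracket Y (bracket X Z).
Proof.
apply: vfield_act_eq => h; apply: Cinf_eq => p.
rewrite act_addv !act_bracket !actB !CinfE; ring.
Qed.

Lemma bracket_antisym X Y : bracket X Y = - bracket Y X.
Proof.
apply/eqP; rewrite -addr_eq0; apply/eqP; apply: vfield_act_eq => h.
by rewrite act_addv !act_bracket addrC subrKA subrr; exact: val_inj.
Qed.

Lemma dform_antisym (e : oneform M) X Y : dform e X Y = - dform e Y X.
Proof.
have fappN Z : fapp e (- Z) = - fapp e Z.
  by apply: Cinf_eq => p; exact: linearN.
rewrite /dform bracket_antisym fappN -scalerN !opprD !opprK.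
by rewrite [act X _ - _]addrC.
Qed.

(** * Bilinearity and definiteness of the metric *)

Section metric.
Variable g : metric M.

(* [Defs.metric_sym] is shadowed by MathComp-Analysis. *)
Lemma metric_swap p (u v : tangent p) : g p u v = g p v u.
Proof. exact: Defs.metric_sym. Qed.

Lemma mappC X Y : mapp g X Y = mapp g Y X.
Proof. by apply: Cinf_eq => p; exact: metric_swap. Qed.

Lemma mappDl X Y Z : mapp g (X + Y) Z = mapp g X Z + mapp g Y Z.
Proof.
apply: Cinf_eq => p; have := metric_linear g (p := p) 1 (X p) (Y p) (Z p).
by rewrite scale1r mul1r.
Qed.

Lemma mappDr X Y Z : mapp g X (Y + Z) = mapp g X Y + mapp g X Z.
Proof. by rewrite mappC mappDl !(mappC _ X). Qed.

Lemma mapp0l X : mapp g 0 X = 0.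
Proof. by apply: (addrI (mapp g 0 X)); rewrite -mappDl !addr0. Qed.

Lemma mappNl X Y : mapp g (- X) Y = - mapp g X Y.
Proof. by apply: (addrI (mapp g X Y)); rewrite -mappDl !subrr mapp0l. Qed.

Lemma mappNr X Y : mapp g X (- Y) = - mapp g X Y.
Proof. by rewrite mappC mappNl mappC. Qed.

Lemma mappBl X Y Z : mapp g (X - Y) Z = mapp g X Z - mapp g Y Z.
Proof. by rewrite mappDl mappNl. Qed.

Lemma mappBr X Y Z : mapp g X (Y - Z) = mapp g X Y - mapp g X Z.
Proof. by rewrite mappDr mappNr. Qed.

Lemma metric_eq0 p (v : tangent p) : g p v v = 0 -> v = 0.
Proof.
move=> gv; apply/eqP; apply: contraT => v0.
by have := metric_gt0 g v0; rewrite gv ltxx.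
Qed.

Lemma metric_ge0 p (v : tangent p) : 0 <= g p v v.
Proof.
have [->|v0] := eqVneq v 0; last exact: ltW (metric_gt0 g v0).
have := metric_linear g (p := p) (-1) 0 0 0.
by rewrite scaler0 addr0 mulN1r addNr => ->.
Qed.

(** Definiteness, applied with [Z = X - Y]. *)
Lemma mapp_inj X Y : (forall Z, mapp g X Z = mapp g Y Z) -> X = Y.
Proof.
move=> XY; apply/eqP; rewrite -subr_eq0; apply/eqP; apply: vfieldP => p.
have : mapp g (X - Y) (X - Y) = 0 by rewrite mappBl XY subrr.
by move=> /(congr1 (fun k : Cinf M => k p)); exact: metric_eq0.
Qed.

Lemma nablaNr (D : connection M) X Y : D X (- Y) = - D X Y.
Proof.
have nabla0r : D X 0 = 0 by apply: (addrI (D X 0)); rewrite -nablaDr !addr0.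
by apply: (addrI (D X Y)); rewrite -nablaDr !subrr.
Qed.

(** * Killing fields and curvature symmetries for the Levi-Civita connection *)

Section levi_civita.
Variable D : connection M.
Hypothesis lc : levi_civita g D.

Let torsion_free X Y : D X Y - D Y X = bracket X Y.
Proof. by have [+ _] := lc; exact. Qed.

Let metric_compat X Y Z :
  act X (mapp g Y Z) = mapp g (D X Y) Z + mapp g Y (D X Z).
Proof. by have [_] := lc; exact. Qed.

(** Put [[xi, Y] = D_xi Y - D_Y xi] into the Killing equation: metric compatibility cancels the
    [D_xi] terms. *)
Lemma killing_skew xi Y Z : killing g xi ->
  mapp g (D Y xi) Z = - mapp g (D Z xi) Y.
Proof.
move=> /(_ Y Z); rewrite metric_compat -!torsion_free mappBl mappBr.
rewrite (mappC Y (D Z xi)) => e; apply: Cinf_eq => p.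
move/(congr1 (fun k : Cinf M => k p)): e.
rewrite !CinfE; lra.
Qed.

(** For [eta = g(., xi)] one has [2 d eta(X, Y) = g(D_X xi, Y) - g(D_Y xi, X)], and the two
    contributions are equal by [killing_skew]. *)
Lemma dform_killing (eta : oneform M) xi X Y : killing g xi ->
  (forall Z, fapp eta Z = mapp g Z xi) -> dform eta X Y = mapp g (D X xi) Y.
Proof.
move=> kxi etaE; rewrite /dform !etaE !metric_compat -torsion_free mappBl.
have := killing_skew X Y kxi; rewrite !(mappC _ (D _ xi)) => e.
apply: Cinf_eq => p; move/(congr1 (fun k : Cinf M => k p)): e.
rewrite !CinfE; lra.
Qed.

Lemma curvature_antisym X Y Z : curvature D X Y Z = - curvature D Y X Z.
Proof.
have nablaDl U V : D (U + V) Z = D U Z + D V Z.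
  by rewrite -[U]scale1r nabla_linearl !scale1r.
have nabla0l : D 0 Z = 0.
  by apply: (addrI (D 0 Z)); rewrite -nablaDl !addr0.
have nablaNl U : D (- U) Z = - D U Z.
  by apply: (addrI (D U Z)); rewrite -nablaDl !subrr.
have -> : curvature D X Y Z = D X (D Y Z) - D Y (D X Z) + D (bracket Y X) Z.
  rewrite /curvature -(torsion_free X) -(opprB (D Y X)) torsion_free.
  by rewrite nablaNl opprK.
by rewrite /curvature !opprB addrC.
Qed.

(** When [[X, Y]] acting on [g(Z, W)] is expanded by metric compatibility, the mixed terms
    [g(D_X Z, D_Y W)] and [g(D_Y Z, D_X W)] cancel. *)
Lemma curvature_skew X Y Z W :
  mapp g (curvature D X Y Z) W = - mapp g (curvature D X Y W) Z.
Proof.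
have := act_bracket X Y (mapp g Z W).
rewrite !metric_compat !actD !metric_compat /curvature => e.
apply: Cinf_eq => p; move/(congr1 (fun k : Cinf M => k p)): e.
rewrite !(mappC _ Z) !mappBl !mappBr !CinfE; lra.
Qed.

End levi_civita.
End metric.
End vector_field_calculus.

(** * Structure equations of a weak f-K-contact manifold *)

Section weak_f_K_contact.
Set Implicit Arguments.
Context {R : realType} {n s : nat} {M : manifold R (n.*2 + s)}.
Variables (f Q : tensor11 M) (xi : 'I_s -> vfield M) (eta : 'I_s -> oneform M).
Variables (g : metric M) (D : connection M).
Hypothesis kc : weak_f_K_contact f Q xi eta g.
Hypothesis lc : levi_civita g D.
Implicit Types (X Y Z : vfield M) (i j : 'I_s) (p : M).

Let wmf : weak_metric_f_structure f Q xi eta g.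
Proof. by have [[]] := kc. Qed.

Let contact i X Y : mapp g X (tapp f Y) = dform (eta i) X Y.
Proof. by have [[_ h] _] := kc; exact: h. Qed.

Let killing_xi i : killing g (xi i).
Proof. by have [_ h] := kc; exact: h. Qed.

(* The index [i] is needed: it is [Phi = d eta^i] that makes [f] skew. *)
Lemma f_skew i X Y : mapp g X (tapp f Y) = - mapp g (tapp f X) Y.
Proof. by rewrite (contact i) dform_antisym -(contact i) mappC. Qed.

(** The axioms give [f^2 xi_i = - Q xi_i + xi_i = 0], which skewness turns into [|f xi_i|^2 = 0]. *)
Lemma tapp_f_xi i : tapp f (xi i) = 0.
Proof.
have ff0 : tapp f (tapp f (xi i)) = 0.
  apply: vfieldP => p; rewrite /= (wmf_sqr wmf) (wmf_Qxi wmf) (bigD1 i) //=.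
  rewrite (wmf_dual wmf) eqxx scale1r big1 ?addr0 ?addNr// => j ji.
  by rewrite (wmf_dual wmf) (negbTE ji) scale0r.
have := f_skew i (xi i) (tapp f (xi i)); rewrite ff0 mappC mapp0l => e.
apply: vfieldP => p; apply: (metric_eq0 g).
have /eqP := congr1 (fun k : Cinf M => k p) e.
by rewrite CinfE eq_sym oppr_eq0 => /eqP.
Qed.

(** As [f xi_i = 0] and [Q xi_i = xi_i], [wmf_compat] at [(X, xi_i)] reads
    [0 = g(X, xi_i) - eta^i(X)]. *)
Lemma etaE i X : fapp (eta i) X = mapp g X (xi i).
Proof.
apply: Cinf_eq => p.
have := wmf_compat wmf (X p) (xi i p).
have -> : f p (xi i p) = 0.
  exact: (congr1 (fun V : vfield M => V p) (tapp_f_xi i)).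
have -> : g p (f p (X p)) 0 = 0.
  have := congr1 (fun k : Cinf M => k p) (mapp0l g (tapp f X)).
  by rewrite mappC.
rewrite (wmf_Qxi wmf) (bigD1 i) //= (wmf_dual wmf) eqxx mulr1 big1 ?addr0.
  by move=> /esym/eqP; rewrite subr_eq0 => /eqP.
by move=> j ji; rewrite (wmf_dual wmf) (negbTE ji) mulr0.
Qed.

Lemma nabla_xi i X : D X (xi i) = - tapp f X.
Proof.
apply: (mapp_inj (g := g)) => Z.
rewrite -(dform_killing lc (eta := eta i)) ?mappNl; first last.
- exact: etaE.
- exact: killing_xi.
by rewrite -(contact i) (f_skew i).
Qed.

Lemma bracket_xi i j : bracket (xi i) (xi j) = 0.
Proof. by have [<- _] := lc; rewrite !nabla_xi !tapp_f_xi subrr. Qed.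

(** This is [L_xi_i eta^j = 0]: [eta^j] is dual to [xi_j], and [L_xi_i] annihilates both [g] and
    [xi_j]. *)
Lemma act_xi_eta i j X :
  act (xi i) (fapp (eta j) X) = fapp (eta j) (bracket (xi i) X).
Proof.
by rewrite !etaE killing_xi bracket_xi [X in _ + X]mappC mapp0l addr0.
Qed.

(* L_xi (d eta) = d (L_xi eta) = 0 *)
Lemma act_xi_dform i j X Y : act (xi i) (dform (eta j) X Y) =
  dform (eta j) (bracket (xi i) X) Y + dform (eta j) X (bracket (xi i) Y).
Proof.
have fappD Z W : fapp (eta j) (Z + W) = fapp (eta j) Z + fapp (eta j) W.
  by apply: Cinf_eq => p; exact: linearD.
rewrite /dform actZ !actB !act_bracket !act_xi_eta bracket_jacobi fappD.
by apply: Cinf_eq => p; rewrite !CinfE; ring.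
Qed.

Lemma bracket_xi_f i X : bracket (xi i) (tapp f X) = tapp f (bracket (xi i) X).
Proof.
apply: (mapp_inj (g := g)) => Z; rewrite ![mapp g _ Z]mappC.
have := killing_xi i Z (tapp f X).
(* The invariances of [g] and of [Phi] share the term [g([xi_i, Z], f X)], which cancels. *)
by rewrite (contact i) act_xi_dform -!(contact i) => /addrI.
Qed.

Lemma curvature_xi i j X : curvature D (xi i) X (xi j) = tapp f (tapp f X).
Proof.
have [tf _] := lc.
have tappB U V : tapp f (U - V) = tapp f U - tapp f V.
  by apply: vfieldP => p; exact: linearB.
have tappN U : tapp f (- U) = - tapp f U.
  by apply: vfieldP => p; exact: linearN.
have D0 U : D U 0 = 0 by apply: (addrI (D U 0)); rewrite -nablaDr !addr0.
(* Both sides of [[xi_i, f X] = f [xi_i, X]] contain [f^2 X], coming from [D xi_i = - f]; the rest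
   says that [f] is parallel along [xi_i]. *)
have nabla_f : D (xi i) (tapp f X) = tapp f (D (xi i) X).
  have := bracket_xi_f i X.
  by rewrite -!tf !nabla_xi tappB tappN opprK => /addIr.
rewrite /curvature !nabla_xi tapp_f_xi oppr0 D0 nablaNr -tf nabla_xi.
by rewrite tappB tappN nabla_f subr0 !opprK addKr.
Qed.

(** The case [i = j] yields the numerator of [K(xi_i, X)]; summing over a frame yields
    [Ric(xi_i, xi_j)]. *)
Lemma curvature_f i j X :
  mapp g (curvature D X (xi i) (xi j)) X = mapp g (tapp f X) (tapp f X).
Proof.
by rewrite (curvature_antisym lc) curvature_xi mappNl [RHS](f_skew i).
Qed.

(** * Pointwise evaluation and positivity of the curvatures *)

Lemma xi_orthonormal i j p : g p (xi i p) (xi j p) = (i == j)%:R.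
Proof.
rewrite eq_sym -(wmf_dual wmf j i p).
exact/esym/(congr1 (fun k : Cinf M => k p) (etaE j (xi i))).
Qed.

(** By [wmf_compat], [g(X, Q X) = |f X|^2 + sum_i eta^i(X)^2]. If this vanishes, the formula for
    [f^2] gives [Q X = 0], so [X = 0]. *)
Lemma metric_Q_gt0 p X : X p != 0 -> 0 < g p (Q p (X p)) (X p).
Proof.
move=> X0; rewrite metric_swap lt_neqAle.
have gQ : g p (X p) (Q p (X p)) =
    g p (f p (X p)) (f p (X p)) + \sum_i (eta i p (X p) : R) ^+ 2.
  by rewrite (wmf_compat wmf) subrK.
have ge := metric_ge0 g (f p (X p)).
have ge' : 0 <= \sum_i (eta i p (X p) : R) ^+ 2.
  by apply: sumr_ge0 => i _; exact: sqr_ge0.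
rewrite gQ addr_ge0// andbT eq_sym paddr_eq0//; apply: contraNN X0.
move=> /andP[/eqP/metric_eq0 fX0].
rewrite psumr_eq0; last by move=> i _; exact: sqr_ge0.
move=> /allP eta0.
have {}eta0 i : eta i p (X p) = 0.
  by have /eta0 := mem_index_enum i; rewrite sqrf_eq0 => /eqP.
have := wmf_sqr wmf (X p); rewrite fX0 linear0 big1; last first.
  by move=> i _; rewrite eta0 scale0r.
move=> /esym/eqP; rewrite addr0 oppr_eq0 => /eqP QX0.
by apply/eqP/(bij_inj (wmf_nonsingular wmf p)); rewrite QX0 linear0.
Qed.

Lemma sectional_xi i p X : in_D eta (X p) -> g p (X p) (X p) = 1 ->
  sectional g D (xi i) X p = g p (Q p (X p)) (X p).
Proof.
move=> DX gX; rewrite /sectional.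
have -> : mapp g (xi i) (xi i) p = 1.
  by have := xi_orthonormal i i p; rewrite eqxx.
have -> : mapp g (xi i) X p = 0.
  by rewrite mappC -etaE; exact: DX.
have -> : mapp g X X p = 1 by [].
(* The two skew-symmetries turn [g(R(xi_i, X) X, xi_i)] into [g(R(X, xi_i) xi_i, X)]. *)
rewrite mulr1 expr0n subr0 divr1 (curvature_skew lc).
rewrite (curvature_antisym lc) mappNl opprK (curvature_f i i X).
have := wmf_compat wmf (X p) (X p).
rewrite big1; last by move=> j _; rewrite DX mul0r.
by rewrite subr0 [RHS]metric_swap.
Qed.

(* If f vanished on the E_a, they would be combinations of the xi_i, that is,
   2n + s orthonormal vectors in a space of dimension s. *)
Lemma f_frame_neq0 p (E : 'I_(n.*2 + s) -> vfield M) : (0 < n)%N ->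
  orthonormal_at g p E -> exists a, f p (E a p) != 0.
Proof.
move=> n_gt0 oE; apply/existsP; apply: contraT; rewrite negb_exists.
move=> /forallP fE0.
(* [C] has only [s] columns, so [C C^T] has rank at most [s] and cannot be the identity of size
   [2n + s]. *)
pose C : 'M[R]_(n.*2 + s, s) := \matrix_(a, i) (eta i p (E a p) : R).
suff CC1 : C *m C^T = 1%:M.
  have := mulmx_max_rank C C^T; rewrite CC1 mxrank1.
  by rewrite -[X in (_ <= X)%N]add0n leq_add2r leqn0 double_eq0 eqn0Ngt n_gt0.
apply/matrixP => a b; rewrite !mxE -oE.
have {}fE0 c : f p (E c p) = 0 by have := fE0 c; rewrite negbK => /eqP.
have QE : Q p (E b p) = E b p.
  have QEsum : Q p (E b p) = \sum_i (eta i p (E b p) : R) *: xi i p.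
    have /esym/eqP := wmf_sqr wmf (E b p).
    by rewrite fE0 linear0 addrC subr_eq0 => /eqP.
  (* [Q E_b] is a combination of the [xi_i], hence fixed by [Q]; injectivity then gives
     [Q E_b = E_b]. *)
  apply: (bij_inj (wmf_nonsingular wmf p)).
  rewrite [in LHS]QEsum linear_sum [RHS]QEsum; apply: eq_bigr => i _.
  by rewrite linearZ /= (wmf_Qxi wmf).
have := wmf_compat wmf (E a p) (E b p); rewrite QE fE0.
have -> : g p 0 (f p (E b p)) = 0.
  exact: (congr1 (fun k : Cinf M => k p) (mapp0l g (tapp f (E b)))).
move=> /esym/eqP; rewrite subr_eq0 => /eqP ->.
by apply: eq_bigr => i _; rewrite !mxE.
Qed.

End weak_f_K_contact.

Theorem corollary5p2 (R : realType) (n s : nat) (n_ge1 : (1 <= n)%N)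
    (s_ge1 : (1 <= s)%N) (M : manifold R (n.*2 + s)) (f Q : tensor11 M)
    (xi : 'I_s -> vfield M) (eta : 'I_s -> oneform M) (g : metric M)
    (nab : connection M) :
  weak_f_K_contact f Q xi eta g -> levi_civita g nab ->
  (forall (i : 'I_s) (p : M) (X : vfield M),
     in_D eta (X p) -> g p (X p) (X p) = 1 ->
     sectional g nab (xi i) X p = g p (Q p (X p)) (X p) /\
     0 < g p (Q p (X p)) (X p)) /\
  (forall (i j : 'I_s) (p : M) (E : 'I_(n.*2 + s) -> vfield M),
     orthonormal_at g p E -> 0 < ricci g nab E (xi i) (xi j) p).
Proof.
move=> kc lc; split=> [i p X DX gX|i j p E oE].
  split; first exact: sectional_xi kc lc _ _ _ DX gX.
  apply: (metric_Q_gt0 kc); apply/eqP => X0.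
  have : g p 0 0 = 0 :> R.
    exact: (congr1 (fun k : Cinf M => k p) (mapp0l g 0)).
  by rewrite -X0 gX => /eqP; rewrite oner_eq0.
have -> : ricci g nab E (xi i) (xi j) p =
    \sum_a g p (f p (E a p)) (f p (E a p)).
  by apply: eq_bigr => a _; rewrite (curvature_f kc lc).
have [a fEa] := f_frame_neq0 kc n_ge1 oE.
(* All terms are nonnegative, and the one at [a] is positive. *)
rewrite (bigD1 a) //= ltr_wpDr ?(metric_gt0 g fEa)//.
by apply: sumr_ge0 => b _; exact: metric_ge0.
Qed.
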